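(* Let $p,q$ be positive integers and let $$K=\{(x,y)\in\mathbb{R}^p\times\mathbb{R}^q:\ x^Tx=1,\ y^Ty=1,\ \mathbf{1}_p^Tx\ge0,\ \mathbf{1}_q^Ty\ge0\}.$$ For each $A\in\mathscr{K}^{p,q}$, the matrix $A$ is separable (i.e., $A\in\mathscr{S}^{p,q}$) if and only if there exists a Borel measure $\mu$ supported in $K$ such that $$A=\int_K(xx^T)\otimes(yy^T)\,\mathrm{d}\mu.$$
   Context: $\mathcal{S}^k$ is the space of real symmetric $k\times k$ matrices, $\mathcal{S}^k_+$ the cone of positive semidefinite ones. $\mathbf{1}_p$ is the all-ones vector in $\mathbb{R}^p$. For $B\in\mathcal{S}^p$, $C\in\mathcal{S}^q$, $B\otimes C=(B_{ik}C)_{1\le i,k\le p}$ is the Kronecker product. $\mathscr{K}^{p,q}=\operatorname{span}\{B\otimes C:B\in\mathcal{S}^p,C\in\mathcal{S}^q\}\subseteq\mathcal{S}^{pq}$. A matrix $A\in\mathscr{K}^{p,q}$ is separable if $A=\sum_{j=1}^LB_j\otimes C_j$ for some $L$ and some $B_j\in\mathcal{S}^p_+$, $C_j\in\mathcal{S}^q_+$; $\mathscr{S}^{p,q}$ is the cone of all separable matrices. Borel measures are nonnegative, and the integral of a matrix-valued function is taken entrywise (and is finite). *)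

(* Defs.v *)
From mathcomp Require Import all_boot all_order all_algebra.
From mathcomp Require Import sesquilinear mxtens.
From mathcomp Require Import all_classical all_reals all_analysis.

Set Implicit Arguments.
Unset Strict Implicit.
Unset Printing Implicit Defensive.

Import Order.TTheory GRing.Theory Num.Theory.
Import numFieldNormedType.Exports.

Local Open Scope classical_set_scope.
Local Open Scope ring_scope.

Section Definitions.
Variable R : realType.

Definition psdmx (k : nat) (A : 'M[R]_k) : Prop :=
  A \is symmetricmx /\ forall v : 'cV[R]_k, 0 <= (v^T *m A *m v) 0 0.

(* [B *t C] has entry [B i k * C j l] at row [i * q + j] and column
   [k * q + l]: it is the block matrix [(B i k *: C)_(i, k)]. *)
Definition kron_span (p q : nat) : set 'M[R]_(p * q) :=
  [set A | exists (L : nat) (a : 'I_L -> R)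
                  (B : 'I_L -> 'M[R]_p) (C : 'I_L -> 'M[R]_q),
     [/\ forall j, B j \is symmetricmx,
         forall j, C j \is symmetricmx
       & A = \sum_(j < L) a j *: (B j *t C j)]].

Definition separable_cone (p q : nat) : set 'M[R]_(p * q) :=
  [set A | kron_span A /\
     exists (L : nat) (B : 'I_L -> 'M[R]_p) (C : 'I_L -> 'M[R]_q),
     [/\ forall j, psdmx (B j),
         forall j, psdmx (C j)
       & A = \sum_(j < L) B j *t C j]].

Definition ones (p : nat) : 'cV[R]_p := const_mx 1.

Definition setK (p q : nat) : set ('cV[R]_p * 'cV[R]_q) :=
  [set z | [/\ (z.1^T *m z.1) 0 0 = 1,
               (z.2^T *m z.2) 0 0 = 1,
               0 <= ((ones p)^T *m z.1) 0 0
             & 0 <= ((ones q)^T *m z.2) 0 0]].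

Definition borelRpq (p q : nat) :=
  g_sigma_algebraType (@open ('cV[R]_p * 'cV[R]_q)%type).

(* For a closed set [D], such as [setK p q], this is the inclusion in [D] of
   the topological support of [mu], since R^p x R^q is second countable. *)
Definition supported_in (p q : nat)
    (mu : {measure set (borelRpq p q) -> \bar R})
    (D : set ('cV[R]_p * 'cV[R]_q)) : Prop :=
  mu (~` D) = 0%E.

Definition is_mx_integral (p q m n : nat)
    (mu : {measure set (borelRpq p q) -> \bar R})
    (D : set ('cV[R]_p * 'cV[R]_q))
    (F : 'cV[R]_p * 'cV[R]_q -> 'M[R]_(m, n)) (A : 'M[R]_(m, n)) : Prop :=
  forall i j,
    mu.-integrable D (fun z : borelRpq p q => (F z i j)%:E) /\
    (\int[mu]_(z in D) (F z i j)%:E)%E = (A i j)%:E.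

End Definitions.

Arguments setK {R} p q.

(* Main.v *)
Require Import Defs.
From mathcomp Require Import all_boot all_order all_algebra.
From mathcomp Require Import sesquilinear mxtens.
From mathcomp Require Import all_classical all_reals all_analysis.
From mathcomp Require Import measurable_realfun ring lra.

(* A psd matrix is a sum of matrices [w w^T], and every such matrix is a
   nonnegative multiple of some [x x^T] with [x] a unit vector whose coordinate
   sum is nonnegative; so a separable matrix is a finite nonnegative combination
   of product states [(x x^T) *t (y y^T)] with [(x, y)] in [setK p q], that is,
   an integral against a finite sum of weighted Dirac masses.
   Conversely, the product states over [setK p q] form a compact set [S] of
   matrices of trace 1, so by Caratheodory's theorem the matrices of trace [t]
   in the cone generated by [S] form a compact set.  If [A] is the integral of
   the product states, its trace is the mass of [mu]; let [P] be the matrix of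
   the same trace in the cone that is nearest to [A].  Then [A - P] is an outer
   normal of the slice at [P], and integrating the corresponding inequality over
   [setK p q] gives [|A - P|^2 <= 0]. *)

Set Implicit Arguments.
Unset Strict Implicit.
Unset Printing Implicit Defensive.

Import Order.TTheory GRing.Theory Num.Theory.
Import numFieldNormedType.Exports.

Local Open Scope classical_set_scope.
Local Open Scope ring_scope.

(** * Positive semidefinite matrices as sums of rank-one terms *)

Section PsdDecomposition.
Variable R : realType.

Lemma symmetricmxP n (B : 'M[R]_n) : reflect (B^T = B) (B \is symmetricmx).
Proof.
apply: (iffP idP) => [/is_hermitianmxP|] BE.
  by rewrite [RHS]BE expr0 scale1r map_mx_id.
by apply/is_hermitianmxP; rewrite expr0 scale1r map_mx_id.
Qed.

Lemma mul_tr_self n (u v : 'cV[R]_n) :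
  (v^T *m (u *m u^T) *m v) 0 0 = (u^T *m v) 0 0 ^+ 2.
Proof.
rewrite mulmxA -mulmxA mxE big_ord1 expr2; congr (_ * _).
by rewrite -[v^T *m u]trmxK trmx_mul trmxK mxE.
Qed.

Lemma psdmx_rank1 n (u : 'cV[R]_n) : psdmx (u *m u^T).
Proof.
split; first by apply/symmetricmxP; rewrite trmx_mul trmxK.
by move=> v; rewrite mul_tr_self sqr_ge0.
Qed.

Lemma psdmxZ n (c : R) (B : 'M[R]_n) : 0 <= c -> psdmx B -> psdmx (c *: B).
Proof.
move=> c0 [/symmetricmxP sB pB]; split.
  by apply/symmetricmxP; rewrite linearZ /= sB.
by move=> v; rewrite -scalemxAr -scalemxAl mxE mulr_ge0.
Qed.

Lemma form_subZ n (B : 'M[R]_n) (v e : 'cV[R]_n) c : B^T = B ->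
  ((v - c *: e)^T *m B *m (v - c *: e)) 0 0 =
  (v^T *m B *m v) 0 0 - 2 * c * (e^T *m B *m v) 0 0
  + c ^+ 2 * (e^T *m B *m e) 0 0.
Proof.
move=> sB; have -> : (v - c *: e)^T = v^T - c *: e^T by rewrite linearB linearZ.
rewrite !mulmxBl !mulmxBr -!scalemxAl -!scalemxAr.
have -> : v^T *m B *m e = (e^T *m B *m v)^T
  by rewrite !trmx_mul trmxK sB mulmxA.
have -> (M N P : 'M[R]_1) :
    (M - c *: N^T - (c *: N - c *: (c *: P))) 0 0 =
    M 0 0 - c * N 0 0 - c * N 0 0 + c * c * P 0 0.
  by rewrite !mxE; ring.
by ring.
Qed.

(** A Schur complement step, removing from [B] its rank-one part along [e]. If the form vanishes at
    [e], the inverse of 0 is 0 and [B] is unchanged. *)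
Definition deflate n (B : 'M[R]_n) (e : 'cV[R]_n) : 'M[R]_n :=
  B - ((e^T *m B *m e) 0 0)^-1 *: ((B *m e) *m (B *m e)^T).

(* Evaluating the form of [B] at [v - c e], where [c] minimises the value,
   gives the form of [deflate B e] at [v]. *)
Lemma psdmx_deflate n (B : 'M[R]_n) (e : 'cV[R]_n) :
  psdmx B -> psdmx (deflate B e).
Proof.
move=> [/symmetricmxP sB pB]; split.
  apply/symmetricmxP; rewrite /deflate linearB linearZ /= sB; congr (_ - _ *: _).
  by rewrite trmx_mul trmxK.
move=> v; rewrite /deflate.
set a := (e^T *m B *m e) 0 0.
have [a0|a0] := eqVneq a 0; first by rewrite a0 invr0 scale0r subr0 pB.
rewrite mulmxBr mulmxBl -scalemxAr -scalemxAl.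
have -> (M N : 'M[R]_1) x : (M - x *: N) 0 0 = M 0 0 - x * N 0 0 by rewrite !mxE.
rewrite mul_tr_self trmx_mul sB; set b := (e^T *m B *m v) 0 0.
have := pB (v - (b / a) *: e).
rewrite form_subZ// -/a -/b => /le_trans; apply; rewrite le_eqVlt; apply/orP; left.
by apply/eqP; field.
Qed.

(** Were [B i j] nonzero, the form at e_j - c e_i would be affine in c with nonzero slope; the c
    chosen below makes it -1. *)
Lemma psdmx_row0 n (B : 'M[R]_n) i j : psdmx B -> B i i = 0 -> B i j = 0.
Proof.
move=> [/symmetricmxP sB pB] Bii.
have dE (k l : 'I_n) :
    ((delta_mx k 0 : 'cV[R]_n)^T *m B *m (delta_mx l 0 : 'cV[R]_n)) 0 0 = B k l.
  by rewrite trmx_delta -rowE -colE !mxE.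
have [//|b0] := eqVneq (B i j) 0.
have := pB (delta_mx j 0 - ((B j j + 1) / (2 * B i j)) *: delta_mx i 0).
rewrite form_subZ// !dE Bii mulr0 addr0.
have -> : B j j - 2 * ((B j j + 1) / (2 * B i j)) * B i j = - 1 :> R by field.
by rewrite ler0N1.
Qed.

(* Row [i] of a psd matrix is killed by deflating along the [i]-th basis
   vector, which keeps the rows already equal to zero. *)
Lemma psdmx_eliminate n (s : seq 'I_n) (B : 'M[R]_n) : psdmx B ->
  exists (r : seq 'cV[R]_n) (B' : 'M[R]_n),
    [/\ B = \sum_(w <- r) w *m w^T + B', psdmx B'
      & forall i j, i \in s -> B' i j = 0].
Proof.
move=> pB; elim: s => [|i s [r [B' [BE pB' B'0]]]].
  by exists [::], B; split => //; rewrite big_nil add0r.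
pose e : 'cV[R]_n := delta_mx i 0.
have aE : (e^T *m B' *m e) 0 0 = B' i i.
  by rewrite trmx_delta -rowE -colE !mxE.
have a0 : 0 <= B' i i by rewrite -aE; apply: pB'.2.
(* The square root moves the weight of the deflated term inside the vector, which is 0 when
   [B' i i = 0]. *)
exists (Num.sqrt (B' i i)^-1 *: (B' *m e) :: r), (deflate B' e); split.
- rewrite big_cons /deflate aE BE linearZ /= -scalemxAl -scalemxAr scalerA.
  rewrite -expr2 sqr_sqrtr ?invr_ge0// [in RHS]addrC -!addrA.
  by rewrite [- _ + _]addrA addNr add0r addrC.
- exact: psdmx_deflate.
- move=> k l; rewrite inE /deflate aE => /orP[/eqP->|ks].
    have [b0|b0] := eqVneq (B' i i) 0.
      by rewrite b0 invr0 scale0r subr0 psdmx_row0.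
    have [/symmetricmxP sB _] := pB'.
    rewrite -colE mxE [X in _ + X]mxE [X in - X]mxE mxE big_ord1 !mxE.
    by rewrite mulrA mulVf// mul1r -[in X in _ - X]sB mxE subrr.
  rewrite -colE mxE [X in _ + X]mxE [X in - X]mxE mxE big_ord1 !mxE.
  by rewrite !(B'0 k)// mul0r mulr0 subr0.
Qed.

Lemma psdmx_sum_rank1 n (B : 'M[R]_n) : psdmx B ->
  exists r : seq 'cV[R]_n, B = \sum_(w <- r) w *m w^T.
Proof.
move=> /(psdmx_eliminate (enum 'I_n))[r [B' [-> _ B'0]]]; exists r.
suff -> : B' = 0 by rewrite addr0.
by apply/matrixP => i j; rewrite B'0 ?mem_enum// mxE.
Qed.

End PsdDecomposition.

(** * Conic combinations and Caratheodory's theorem *)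

Section ConicHull.
Variables (R : realType) (n : nat) (S : set 'rV[R]_n).

Definition conic_sum (L : nat) : set 'rV[R]_n :=
  [set a | exists (c : 'I_L -> R) (v : 'I_L -> 'rV[R]_n),
    [/\ forall i, 0 <= c i, forall i, S (v i) & a = \sum_i c i *: v i]].

Lemma conic_sum_addZ L a c v :
  0 <= c -> S v -> conic_sum L a -> conic_sum L.+1 (c *: v + a).
Proof.
move=> c0 Sv [d [w [d0 Sw ->]]].
exists (fun i => if unlift ord0 i is Some j then d j else c).
exists (fun i => if unlift ord0 i is Some j then w j else v).
split=> [i|i|]; [by case: unlift|by case: unlift|].
rewrite big_ord_recl unlift_none; congr (_ + _).
by apply: eq_bigr => i _; rewrite liftK.
Qed.

Lemma conic_sumZ L a c : 0 <= c -> conic_sum L a -> conic_sum L (c *: a).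
Proof.
move=> c0 [d [w [d0 Sw ->]]]; exists (fun i => c * d i), w; split => //.
  by move=> i; rewrite mulr_ge0.
by rewrite scaler_sumr; apply: eq_bigr => i _; rewrite scalerA.
Qed.

Lemma linear_dependence L (v : 'I_L -> 'rV[R]_n) : (n < L)%N ->
  exists u : 'I_L -> R, \sum_i u i *: v i = 0 /\ exists i, 0 < u i.
Proof.
move=> nL; pose W : 'M[R]_(L, n) := \matrix_i v i.
have : kermx W != 0.
  rewrite -mxrank_eq0 mxrank_ker subn_eq0 -ltnNge.
  exact: (leq_ltn_trans (rank_leq_col _)).
move=> /rowV0Pn[u /sub_kermxP uW /rV0Pn[i ui0]].
have uS : \sum_i u 0 i *: v i = 0.
  by rewrite -[RHS]uW mulmx_sum_row; apply: eq_bigr => j _; rewrite rowK.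
(* A relation whose known nonzero coefficient is negative is negated, so that some coefficient is
   positive. *)
have [ui|ui|ui] := ltrgtP (u 0 i) 0; last by rewrite ui eqxx in ui0.
  exists (fun i => - u 0 i); split; last by exists i; rewrite oppr_gt0.
  by under eq_bigr do rewrite scaleNr; rewrite sumrN uS oppr0.
by exists (u 0); split => //; exists i.
Qed.

(* Subtracting from the coefficients the largest admissible multiple of a
   linear relation makes one of them vanish. *)
Lemma caratheodory_step L : (n <= L)%N -> conic_sum L.+1 `<=` conic_sum L.
Proof.
move=> nL a [c [v [c0 Sv ->]]].
have [u [uS [i1 ui1]]] := @linear_dependence L.+1 v nL.
(* The least ratio [c i / u i] over [u i > 0] is the largest multiple keeping all coefficients
   nonnegative; coefficient [i] then vanishes. *)
case: (@Order.TotalTheory.arg_minP _ _ _ i1 (fun i => 0 < u i)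
  (fun i => c i / u i) ui1) => i ui imin.
pose t := c i / u i.
have t0 : 0 <= t by rewrite divr_ge0 // ltW.
pose d j := c j - t * u j.
have d0 j : 0 <= d j.
  rewrite subr_ge0; have [uj|uj] := ltrP 0 (u j).
    by rewrite -ler_pdivlMr// imin.
  by rewrite (le_trans _ (c0 j))// mulr_ge0_le0.
have di : d i = 0 by rewrite /d /t divfK ?subrr// gt_eqF.
exists (fun j => d (lift i j)), (fun j => v (lift i j)); split => //.
transitivity (\sum_j d j *: v j).
  under [RHS]eq_bigr do rewrite scalerBl -scalerA.
  by rewrite sumrB -scaler_sumr uS scaler0 subr0.
by rewrite (bigD1_ord i)//= di scale0r add0r.
Qed.

Lemma conic_sum_widen L m :
  S !=set0 -> (L <= m)%N -> conic_sum L `<=` conic_sum m.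
Proof.
move=> [v Sv] /subnK <-; elim: (m - L)%N => // k IH a /IH; rewrite addSn.
by move=> /(conic_sum_addZ (lexx 0) Sv); rewrite scale0r add0r.
Qed.

(** Long sums are shortened one term at a time; short ones are padded with zero coefficients on a
    point of [S]. *)
Lemma caratheodory L : S !=set0 -> conic_sum L `<=` conic_sum n.
Proof.
move=> S0; elim: L => [|L IH] a aL; first exact: (conic_sum_widen S0 (leq0n n)).
have [nL|Ln] := leqP n L; first exact/IH/caratheodory_step.
exact: conic_sum_widen aL.
Qed.

(* The bound on the coefficients makes these sets compact when [S] is. *)
Definition bounded_conic_sum (t : R) (L : nat) : set 'rV[R]_n :=
  [set a | exists (c : 'I_L -> R) (v : 'I_L -> 'rV[R]_n),
    [/\ forall i, 0 <= c i <= t, forall i, S (v i) & a = \sum_i c i *: v i]].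

(** Splitting off the first term presents the set as a continuous image of a product, so that
    compactness follows by induction on [L]. *)
Lemma bounded_conic_sumS t L : bounded_conic_sum t L.+1 =
  [set x.1.1 *: x.1.2 + x.2 | x in (`[0, t] `*` S) `*` bounded_conic_sum t L].
Proof.
apply/seteqP; split=> [a [c [v [ct Sv ->]]]|_
  [[[c v] a] /= [[ct Sv] [d [w [dt Sw ->]]]] <-]].
  exists ((c ord0, v ord0), \sum_(i < L) c (lift ord0 i) *: v (lift ord0 i)).
    split; first by split => //=; rewrite in_itv/= ct.
    by exists (fun i => c (lift ord0 i)), (fun i => v (lift ord0 i)).
  by rewrite big_ord_recl.
rewrite /= in_itv/= in ct.
exists (fun i => if unlift ord0 i is Some j then d j else c).
exists (fun i => if unlift ord0 i is Some j then w j else v).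
split=> [i|i|]; [by case: unlift|by case: unlift|].
rewrite big_ord_recl unlift_none; congr (_ + _).
by apply: eq_bigr => i _; rewrite liftK.
Qed.

Lemma compact_bounded_conic_sum t L :
  compact S -> compact (bounded_conic_sum t L).
Proof.
move=> cS; elim: L => [|L IH].
  suff -> : bounded_conic_sum t 0 = [set 0] by exact: compact_set1.
  apply/seteqP; split=> [a [c [v [_ _ ->]]]|_ ->]; first by rewrite big_ord0.
  by exists (fun=> 0), (fun=> 0); split=> [[]|[]|] //; rewrite big_ord0.
rewrite bounded_conic_sumS; apply: continuous_compact; last first.
  by apply: compact_setX => //; apply: compact_setX => //; exact: segment_compact.
apply: continuous_subspaceT => x.
apply: cvgD; last exact: cvg_snd.
apply: cvgZ; [apply: (@cvg_comp _ _ _ fst fst); [exact: cvg_fst|exact: cvg_fst]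
  |apply: (@cvg_comp _ _ _ fst snd); [exact: cvg_fst|exact: cvg_snd]].
Qed.

End ConicHull.

(** * The Euclidean inner product on row vectors *)

Section Dot.
Variables (R : realType) (n : nat).
Implicit Types u v w : 'rV[R]_n.

Definition dot u v : R := \sum_k u 0 k * v 0 k.

Lemma dotC u v : dot u v = dot v u.
Proof. by apply: eq_bigr => k _; rewrite mulrC. Qed.

Lemma dotDr u v w : dot u (v + w) = dot u v + dot u w.
Proof. by rewrite -big_split; apply: eq_bigr => k _; rewrite mxE mulrDr. Qed.

Lemma dotZr c u v : dot u (c *: v) = c * dot u v.
Proof. by rewrite mulr_sumr; apply: eq_bigr => k _; rewrite mxE mulrCA. Qed.

Lemma dotBr u v w : dot u (v - w) = dot u v - dot u w.
Proof. by rewrite dotDr -scaleN1r dotZr mulN1r. Qed.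

Lemma dotZl c u v : dot (c *: u) v = c * dot u v.
Proof. by rewrite dotC dotZr dotC. Qed.

Lemma dot0r u : dot u 0 = 0.
Proof. by rewrite -(scale0r u) dotZr mul0r. Qed.

Lemma dot_sumr I (r : seq I) u (F : I -> 'rV[R]_n) :
  dot u (\sum_(i <- r) F i) = \sum_(i <- r) dot u (F i).
Proof. exact: (big_morph (dot u) (dotDr u) (dot0r u)). Qed.

Lemma dot_ge0 u : 0 <= dot u u.
Proof. by apply: sumr_ge0 => k _; rewrite -expr2 sqr_ge0. Qed.

Lemma dot_eq0 u : dot u u = 0 -> u = 0.
Proof.
move=> /eqP; rewrite psumr_eq0 => [/allP u0|k _]; last by rewrite -expr2 sqr_ge0.
apply/rowP => k; have := u0 k (mem_index_enum k).
by rewrite /= -expr2 sqrf_eq0 mxE => /eqP.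
Qed.

Lemma dot_sqrB u v : dot (u - v) (u - v) = dot u u - 2 * dot u v + dot v v.
Proof. by rewrite dotBr !(dotC (u - v)) !dotBr (dotC v u); ring. Qed.

Lemma dot_continuous (T : topologicalType) (F G : T -> 'rV[R]_n) :
  continuous F -> continuous G -> continuous (fun x => dot (F x) (G x)).
Proof.
move=> cF cG; apply: (@continuous_big R _ +%R 0 xpredT).
  exact: add_continuous.
move=> k _ x; apply: cvgM.
  exact: (cvg_comp _ _ (cF x) (@coord_continuous R 1 n 0 k (F x))).
exact: (cvg_comp _ _ (cG x) (@coord_continuous R 1 n 0 k (G x))).
Qed.

End Dot.

(** * Barycenters of a compact set in the hyperplane [dot w x = 1] *)

Section Barycenter.
Variables (R : realType) (n : nat) (S : set 'rV[R]_n) (w : 'rV[R]_n).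
Hypotheses (cS : compact S) (Sw : forall v, S v -> dot w v = 1).

Let slice (t : R) : set 'rV[R]_n :=
  bounded_conic_sum S t n `&` [set x | dot w x = t].

(** As [dot w] is 1 on [S], the coefficients sum to [t], so bounding each of them by [t] loses
    nothing. *)
Let sliceP t L P : S !=set0 -> conic_sum S L P -> dot w P = t -> slice t P.
Proof.
move=> S0 /(caratheodory S0)[c [v [c0 Sv ->]]] wP; split => //.
exists c, v; split => // i; rewrite c0 -wP dot_sumr (bigD1 i)//= dotZr Sw// mulr1.
by rewrite lerDl sumr_ge0// => j _; rewrite dotZr Sw// mulr1.
Qed.

(* [P] is the point closest to [a] in the slice [dot w x = t] of the cone
   generated by [S]; the inequality says that [a - P] is an outer normal. *)
Lemma conic_slice_projection (a : 'rV[R]_n) (t : R) : S !=set0 -> 0 <= t ->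
  exists P, [/\ conic_sum S n P, dot w P = t
    & forall z, S z -> t * dot (a - P) z <= dot (a - P) P].
Proof.
move=> S0 t0; have St z : S z -> conic_sum S 1 (t *: z).
  by move=> Sz; exists (fun=> t), (fun=> z); split=> //; rewrite big_ord1.
have slice0 : slice t !=set0.
  have [z Sz] := S0; exists (t *: z); apply: sliceP (St _ Sz) _ => //.
  by rewrite dotZr Sw ?mulr1.
have cslice : compact (slice t).
  apply: subclosed_compact (@compact_bounded_conic_sum _ _ _ t n cS) _; last first.
    by move=> x [].
  apply: closedI; last first.
    apply: (@preimage_closed _ _ (dot w) [set t]).
      move=> x _; apply: (@dot_continuous _ _ _ (fun=> w) id) => y.
        exact: cst_continuous.
      exact: cvg_id.
    exact: closed_eq.
  apply: compact_closed; last exact: compact_bounded_conic_sum.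
  exact: norm_hausdorff.
have cf : continuous (fun x : 'rV[R]_n => dot (a - x) (a - x)).
  have cB : continuous (fun x : 'rV[R]_n => a - x).
    move=> x; apply: (@continuousB R _ _ (fun=> a) id x).
      exact: cst_continuous.
    exact: cvg_id.
  exact: dot_continuous.
have [P] := compact_EVT_min slice0 cslice (continuous_subspaceT cf).
rewrite inE => -[[c [v [c0 Sv PE]]] wP] Pmin.
have PS : conic_sum S n P.
  by exists c, v; split => // i; have /andP[] := c0 i.
exists P; split => // z Sz.
set u := a - P; pose q := t *: z - P.
rewrite -dotZr -subr_le0 -dotBr -/q.
set g := dot u q; pose h := dot q q.
have h0 : 0 <= h := dot_ge0 q.
rewrite leNgt; apply/negP => g0.
(* Moving from [P] to [P + s *: q] lowers the squared distance to [a] by [2 * s * g - s ^+ 2 * h].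
   This choice of [s] is at most 1 and gives [s * h <= g < 2 * g], against minimality. *)
pose s := g / (h + g).
have hg0 : 0 < h + g by rewrite ltr_wpDl.
have s01 : 0 < s <= 1.
  by rewrite divr_gt0//= ler_pdivrMr// mul1r lerDr.
have /andP[s0 s1] := s01.
have : slice t (P + s *: q).
  have PqE : P + s *: q = (s * t) *: z + (1 - s) *: P.
    by rewrite /q scalerBr scalerA scalerBl scale1r addrCA.
  (* The convex combination of [t *: z] and [P] has [n.+1] terms; Caratheodory brings it back to
     [n]. *)
  apply: (@sliceP _ n.+1) => //.
    rewrite PqE; apply: conic_sum_addZ => //; first by rewrite mulr_ge0// ltW.
    by apply: conic_sumZ => //; rewrite subr_ge0.
  by rewrite PqE dotDr !dotZr Sw// wP; ring.
move=> /mem_set/Pmin; rewrite opprD addrA -/u.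
rewrite (dot_sqrB u) dotZl !dotZr -/g -/h => Pmin'.
have : 2 * g <= s * h by rewrite -(ler_pM2l s0); lra.
rewrite /s mulrAC ler_pdivlMr// (mulrC 2) -mulrA ler_pM2l//.
lra.
Qed.

Lemma conic_barycenter d (T : measurableType d) (mu : {measure set T -> \bar R})
    (D : set T) (F : T -> 'rV[R]_n) (a : 'rV[R]_n) :
  measurable D -> (forall z, D z -> S (F z)) ->
  (forall k, mu.-integrable D (fun z => (F z 0 k)%:E)) ->
  (forall k, (\int[mu]_(z in D) (F z 0 k)%:E = (a 0 k)%:E)%E) ->
  exists L, conic_sum S L a.
Proof.
move=> mD DS iF aE.
have sE (u : 'rV[R]_n) z :
    (dot u (F z))%:E = (\sum_k (u 0 k)%:E * (F z 0 k)%:E)%E.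
  by rewrite -sumEFin.
have iZ (u : 'rV[R]_n) k :
    mu.-integrable D (fun z => (u 0 k)%:E * (F z 0 k)%:E)%E.
  exact: integrableZl.
have i_dot u : mu.-integrable D (fun z => (dot u (F z))%:E).
  under eq_fun do rewrite sE.
  by apply: integrable_sum => // k _; exact: (iZ u).
have int_dot u : (\int[mu]_(z in D) (dot u (F z))%:E = (dot u a)%:E)%E.
  under eq_integral do rewrite sE.
  rewrite integral_sum// /dot -sumEFin; apply: eq_bigr => k _.
  by rewrite integralZl// aE.
set t := dot w a.
(* [dot w (F z)] is 1 on [D], so the mass of [D] is [dot w a], in particular finite. *)
have muD : mu D = t%:E.
  rewrite -int_dot -[LHS]mul1e -integral_cst//.
  by apply: eq_integral => z /set_mem /DS /Sw ->.
have t0 : 0 <= t by rewrite -lee_fin -muD.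
(* Zero mass is treated apart, because the last inequality is divided by [t]; there [a = 0] is the
   empty sum. *)
have [t_eq0|t_neq0] := eqVneq t 0.
  exists 0%N, (fun=> 0), (fun=> 0); split => [[]|[]|] //; rewrite big_ord0.
  apply/rowP => k; rewrite mxE; apply: EFin_inj; rewrite -aE.
  apply: null_set_integral; [by []|exact: measurable_int (iF k)|].
  by rewrite muD t_eq0.
have S0 : S !=set0.
  have [D0|/set0P[z /DS]] := eqVneq D set0; last by exists (F z).
  by case/eqP: t_neq0; apply: EFin_inj; rewrite -muD D0 measure0.
have [P [PS wP nP]] := conic_slice_projection a S0 t0.
exists n; suff <- : P = a by [].
apply/esym/eqP; rewrite -subr_eq0; apply/eqP/dot_eq0/eqP.
set u := a - P; rewrite eq_le dot_ge0 andbT.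
(* Since [dot w (F z) = 1], the constant [dot u P] is also linear in [F z]. Both sides of the normal
   inequality then integrate to their values at [a]. *)
have : dot (t *: u) a <= dot (dot u P *: w) a.
  rewrite -lee_fin -!int_dot; apply: le_integral => // z /set_mem /DS Sz.
  by rewrite lee_fin !dotZl Sw// mulr1 nP.
rewrite !dotZl -/t mulrC ler_pM2r ?lt_neqAle 1?eq_sym ?t_neq0//.
by rewrite {3}/u dotBr subr_le0.
Qed.

End Barycenter.

(** * Matrix coordinates, continuity and trace *)

Lemma continuous_mx (R : realType) (T : topologicalType) m n
    (f : T -> 'M[R]_(m, n)) :
  (forall i j, continuous (fun x => f x i j)) -> continuous f.
Proof.
move=> cf x; apply/cvg_ballP => e e0.
have : \forall y \near x, forall i j, ball (f x i j) e (f y i j).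
  apply: filter_forall => i; apply: filter_forall => j.
  by have /cvg_ballP := cf i j x; apply.
by apply: filterS => y.
Qed.

Lemma mxtrace_tens (R : pzRingType) m n (A : 'M[R]_m) (B : 'M[R]_n) :
  \tr (A *t B) = \tr A * \tr B.
Proof. by rewrite mulr_sum; apply: eq_bigr => i _; rewrite mxE. Qed.

Lemma mul_col_trE (R : pzRingType) n (x : 'cV[R]_n) i j :
  (x *m x^T) i j = x i 0 * x j 0.
Proof. by rewrite mxE big_ord1 !mxE. Qed.

Lemma norm_colE (R : pzRingType) n (x : 'cV[R]_n) :
  (x^T *m x) 0 0 = \sum_i x i 0 ^+ 2.
Proof. by rewrite mxE; apply: eq_bigr => i _; rewrite mxE expr2. Qed.

Lemma ones_mulE (R : realType) n (x : 'cV[R]_n) :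
  ((ones R n)^T *m x) 0 0 = \sum_i x i 0.
Proof. by rewrite mxE; apply: eq_bigr => i _; rewrite !mxE mul1r. Qed.

(** The trace becomes a functional [dot w], so that trace 1 is the hyperplane condition of the
    barycenter argument. *)
Lemma dot_mxvec1 (R : realType) n (A : 'M[R]_n) :
  dot (mxvec 1%:M) (mxvec A) = \tr A.
Proof.
transitivity (\sum_i \sum_j (1%:M : 'M[R]_n) i j * A i j).
  rewrite pair_bigA /dot (reindex _ (curry_mxvec_bij n n)).
  by apply: eq_bigr => -[i j] _ /=; rewrite !mxvecE.
apply: eq_bigr => i _; rewrite (bigD1 i)//= big1 ?addr0 => [|j /negPf ji].
  by rewrite mxE eqxx mul1r.
by rewrite mxE eq_sym ji mul0r.
Qed.

(** * Product states, and the topology and measurability of [setK] *)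

Section ProductSphere.
Variables (R : realType) (p q : nat).
Local Notation T := ('cV[R]_p * 'cV[R]_q)%type.

Definition product_state (z : T) : 'M[R]_(p * q) :=
  (z.1 *m z.1^T) *t (z.2 *m z.2^T).

Lemma fst_coord_continuous i : continuous (fun z : T => z.1 i 0).
Proof.
move=> z; apply: (cvg_comp fst (fun x : 'cV[R]_p => x i 0)); first exact: cvg_fst.
exact: coord_continuous.
Qed.

Lemma snd_coord_continuous i : continuous (fun z : T => z.2 i 0).
Proof.
move=> z; apply: (cvg_comp snd (fun x : 'cV[R]_q => x i 0)); first exact: cvg_snd.
exact: coord_continuous.
Qed.

Lemma product_stateE z i j : product_state z i j =
  z.1 (mxtens_unindex i).1 0 * z.1 (mxtens_unindex j).1 0
  * (z.2 (mxtens_unindex i).2 0 * z.2 (mxtens_unindex j).2 0).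
Proof. by rewrite /product_state mxE !mul_col_trE. Qed.

Lemma product_state_continuous i j : continuous (fun z => product_state z i j).
Proof.
under eq_fun do rewrite product_stateE.
move=> z; apply: (@continuousM R T (fun z => z.1 _ 0 * z.1 _ 0)
  (fun z => z.2 _ 0 * z.2 _ 0)).
  by apply: (@continuousM R T (fun z => z.1 _ 0)); exact: fst_coord_continuous.
by apply: (@continuousM R T (fun z => z.2 _ 0)); exact: snd_coord_continuous.
Qed.

Lemma continuous_sum n (F : 'I_n -> T -> R) :
  (forall i, continuous (F i)) -> continuous (fun z => \sum_i F i z).
Proof.
move=> cF; apply: (@continuous_big R _ +%R 0 xpredT) => [|i _]; last exact: cF.
exact: add_continuous.
Qed.

Lemma setK_closed : closed (setK p q : set T).
Proof.
have -> : setK p q =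
    (fun z : T => \sum_i z.1 i 0 ^+ 2) @^-1` [set x | x = 1] `&`
    (fun z : T => \sum_i z.2 i 0 ^+ 2) @^-1` [set x | x = 1] `&`
    (fun z : T => \sum_i z.1 i 0) @^-1` [set x | 0 <= x] `&`
    (fun z : T => \sum_i z.2 i 0) @^-1` [set x | 0 <= x].
  apply/seteqP; split => z; rewrite /setK /= !norm_colE !ones_mulE.
    by case.
  by move=> [[[]]].
do 3?[apply: closedI]; apply: preimage_closed; try exact: closed_eq;
  try exact: closed_ge; move=> z _; apply: continuous_sum => i {}z.
- by apply: (@continuousM R T (fun z => z.1 i 0)); exact: fst_coord_continuous.
- by apply: (@continuousM R T (fun z => z.2 i 0)); exact: snd_coord_continuous.
- exact: fst_coord_continuous.
- exact: snd_coord_continuous.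
Qed.

Lemma setK_measurable : measurable (setK p q : set (borelRpq R p q)).
Proof.
rewrite -[setK p q]setCK; apply: measurableC; apply: sub_sigma_algebra.
by rewrite openC; exact: setK_closed.
Qed.

(** It suffices to test open intervals, whose preimages are open. *)
Lemma continuous_borel_measurable (f : T -> R) :
  continuous f -> measurable_fun setT (f : borelRpq R p q -> R).
Proof.
move=> /continuousP cf.
apply: (measurability _ (RGenOpens.measurableE R)) => _ [_ [a [b ->] <-]].
by rewrite setTI; apply: sub_sigma_algebra; apply: cf; exact: interval_open.
Qed.

Lemma compact_cV_box n (M : R) :
  compact [set x : 'cV[R]_n | forall i, `[- M, M]%classic (x i 0)].
Proof.
have -> : [set x : 'cV[R]_n | forall i, `[- M, M]%classic (x i 0)] =
    trmx @` [set x : 'rV[R]_n | forall i, `[- M, M]%classic (x 0 i)].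
  apply/seteqP; split => [x xM|_ [x xM <-] i]; last by rewrite mxE.
  by exists x^T; rewrite ?trmxK// => i; rewrite mxE.
apply: continuous_compact.
  apply: continuous_subspaceT; apply: continuous_mx => i j.
  under eq_fun do rewrite mxE.
  exact: (@coord_continuous R 1 n j i).
by apply: (@rV_compact R n (fun=> `[- M, M]%classic)) => i; exact: segment_compact.
Qed.

Lemma unit_coord_bound n (x : 'cV[R]_n) i :
  (x^T *m x) 0 0 = 1 -> `[- 1, 1]%classic (x i 0).
Proof.
move=> x1; have : x i 0 ^+ 2 <= 1.
  rewrite -x1 norm_colE (bigD1 i)//= lerDl.
  by apply: sumr_ge0 => j _; exact: sqr_ge0.
rewrite /= in_itv/= -ler_norml -[in X in _ -> X](@ler_pXn2r _ 2) ?nnegrE//.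
by rewrite expr1n real_normK ?num_real.
Qed.

(** A closed subset of a product of two boxes, as unit vectors have coordinates in [-1, 1]. *)
Lemma setK_compact : compact (setK p q : set T).
Proof.
apply: subclosed_compact setK_closed
  (compact_setX (@compact_cV_box p 1) (@compact_cV_box q 1)) _.
by move=> z [z1 z2 _ _]; split => i; exact: unit_coord_bound.
Qed.

Lemma mxtrace_product_state z : setK p q z -> \tr (product_state z) = 1.
Proof.
move=> [z1 z2 _ _].
by rewrite mxtrace_tens !(mxtrace_mulC _ _^T) !trace_mx11 z1 z2 mulr1.
Qed.

End ProductSphere.

(** * Finite sums of weighted Dirac masses *)

Section AtomicMeasure.
Context d (T : measurableType d) (R : realType) (D : set T).
Hypothesis mD : measurable D.

(** The scaling rule is applied to the positive and negative parts of [f] separately. *)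
Lemma integral_mscale_dirac (c : {nonneg R}) (x : T) (f : T -> \bar R) :
  D x -> measurable_fun D f ->
  (\int[mscale c (dirac x)]_(y in D) f y = c%:num%:E * f x)%E.
Proof.
move=> Dx mf; have dE (g : T -> \bar R) : measurable_fun D g ->
    (\int[dirac x]_(y in D) g y = g x)%E.
  by move=> mg; rewrite integral_dirac// diracE mem_set// mul1e.
rewrite integralE !ge0_integral_mscale//; last 2 first.
  exact: measurable_funeneg.
  exact: measurable_funepos.
rewrite !dE; [|exact: measurable_funeneg|exact: measurable_funepos].
by rewrite [in RHS](funeposneg f) muleBr// add_def_funeposneg.
Qed.

(** Induction on [r], adding to the zero measure one mass [c i] at [x i] at a time. *)
Lemma atomic_measure (I : Type) (r : seq I) (c : I -> R) (x : I -> T) :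
  (forall i, 0 <= c i) -> (forall i, D (x i)) ->
  exists mu : {measure set T -> \bar R}, mu (~` D) = 0%E /\
    forall f : T -> R, measurable_fun D f ->
      mu.-integrable D (EFin \o f) /\
      (\int[mu]_(y in D) (f y)%:E = (\sum_(i <- r) c i * f (x i))%:E)%E.
Proof.
move=> c0 Dx; elim: r => [|i r [mu [muD muf]]].
  exists mzero; split => // f mf; rewrite big_nil; split; last first.
    exact: integral_measure_zero.
  apply/integrableP; split; first exact/measurable_EFinP.
  by rewrite integral_measure_zero.
pose nu := mscale (NngNum (c0 i)) (dirac (x i)).
exists (measure_add nu mu); split.
  transitivity (nu (~` D) + mu (~` D))%E; first exact: measure_addE.
  by rewrite muD adde0 /nu /mscale /= diracE memNset ?mule0// => /(_ (Dx i)).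
move=> f mf; have [if_ intf] := muf f mf.
have mEf : measurable_fun D (EFin \o f) by exact/measurable_EFinP.
have inu : nu.-integrable D (EFin \o f).
  apply/integrableP; split => //.
  rewrite integral_mscale_dirac//=; first by rewrite -EFinM ltry.
  by apply/measurable_EFinP; exact: measurableT_comp.
split; last first.
  by rewrite integral_measure_add// intf integral_mscale_dirac// big_cons.
apply/integrableP; split => //.
rewrite ge0_integral_measure_add//; last exact: measurableT_comp.
by rewrite lte_add_pinfty//; [case/integrableP: inu|case/integrableP: if_].
Qed.

End AtomicMeasure.

(** * Tensor products and reduction to unit vectors *)

Lemma tensZmx (R : comPzRingType) m n p q c
    (A : 'M[R]_(m, n)) (B : 'M[R]_(p, q)) :
  (c *: A) *t B = c *: (A *t B).
Proof. by apply/matrixP => i j; rewrite !mxE mulrA. Qed.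

Lemma tensmxZ (R : comPzRingType) m n p q c
    (A : 'M[R]_(m, n)) (B : 'M[R]_(p, q)) :
  A *t (c *: B) = c *: (A *t B).
Proof. by apply/matrixP => i j; rewrite !mxE mulrCA. Qed.

Lemma tensmx_sum (R : comPzRingType) m n p q (I J : Type)
    (r : seq I) (s : seq J)
    (F : I -> 'M[R]_(m, n)) (G : J -> 'M[R]_(p, q)) :
  (\sum_(i <- r) F i) *t (\sum_(j <- s) G j) =
  \sum_(i <- r) \sum_(j <- s) F i *t G j.
Proof.
apply/matrixP => k l; rewrite mxE !summxE big_distrlr /=.
by apply: eq_bigr => i _; rewrite summxE; apply: eq_bigr => j _; rewrite mxE.
Qed.

(** For nonzero [w], take [x] to be [w] divided by its norm, up to a sign that makes the coordinate
    sum nonnegative and disappears from [x *m x^T]. *)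
Lemma unit_rescale (R : realType) n (w : 'cV[R]_n) : (0 < n)%N ->
  exists (c : R) (x : 'cV[R]_n),
    [/\ 0 <= c, (x^T *m x) 0 0 = 1, 0 <= ((ones R n)^T *m x) 0 0
      & w *m w^T = c *: (x *m x^T)].
Proof.
move=> n0; have [->|w0] := eqVneq w 0.
  (* For [w = 0] any admissible unit vector serves; a basis vector exists because [n] is
     positive. *)
  exists 0, (delta_mx (Ordinal n0) 0); split=> //.
  - by rewrite trmx_delta mul_delta_mx mxE eqxx.
  - by rewrite ones_mulE; apply: sumr_ge0 => i _; rewrite mxE ler0n.
  - by rewrite mul0mx scale0r.
pose N := (w^T *m w) 0 0.
have N0 : 0 < N.
  rewrite /N norm_colE lt_neqAle eq_sym psumr_neq0 => [|i _]; last exact: sqr_ge0.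
  rewrite sumr_ge0 ?andbT => [|i _]; last exact: sqr_ge0.
  have [i wi] : exists i, w i 0 != 0.
    have /matrix0Pn[i [j]] := w0; rewrite (ord1 j) => wi; by exists i.
  apply/hasP; exists i; rewrite ?mem_index_enum//.
  by rewrite lt_neqAle eq_sym sqrf_eq0 wi sqr_ge0.
pose sg : R := if 0 <= ((ones R n)^T *m w) 0 0 then 1 else -1.
have sg2 : sg ^+ 2 = 1 by rewrite /sg; case: ifP; rewrite ?sqrrN expr1n.
pose k := sg / Num.sqrt N.
have k2 : k * k = N^-1 by rewrite -expr2 expr_div_n sg2 sqr_sqrtr ?ltW// div1r.
have tkw : (k *: w)^T = k *: w^T by rewrite linearZ.
exists N, (k *: w); split; first exact: ltW.
- by rewrite tkw -scalemxAl -scalemxAr scalerA k2 mxE mulVf// gt_eqF.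
- rewrite -scalemxAr mxE /k mulrAC divr_ge0// ?sqrtr_ge0// /sg.
  by case: ifPn; rewrite ?mul1r// -ltNge mulN1r oppr_ge0 => /ltW.
- by rewrite tkw -scalemxAl -scalemxAr !scalerA -mulrA k2 mulfV ?scale1r// gt_eqF.
Qed.

(** Both factors of each term split into rank-one matrices, and the tensor product distributes over
    the sums. *)
Lemma separable_product_states (R : realType) p q (A : 'M[R]_(p * q)) :
  separable_cone A ->
  exists r : seq ('cV[R]_p * 'cV[R]_q), A = \sum_(z <- r) product_state z.
Proof.
move=> [_ [L [B [C [pB pC ->]]]]].
have /choice[rB rBE] : forall j, exists r : seq 'cV[R]_p,
     B j = \sum_(w <- r) w *m w^T.
  by move=> j; exact: psdmx_sum_rank1.
have /choice[rC rCE] : forall j, exists r : seq 'cV[R]_q,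
     C j = \sum_(w <- r) w *m w^T.
  by move=> j; exact: psdmx_sum_rank1.
exists (flatten
  [seq [seq (w, u) | w <- rB j, u <- rC j] | j <- index_enum 'I_L]).
rewrite big_flatten big_map; apply: eq_bigr => j _.
by rewrite big_allpairs rBE rCE tensmx_sum.
Qed.

Theorem proposition4p1 (R : realType) (p q : nat) (hp : (0 < p)%N)
    (hq : (0 < q)%N) (A : 'M[R]_(p * q)) (hA : kron_span A) :
  separable_cone A <->
  exists mu : {measure set (borelRpq R p q) -> \bar R},
    supported_in mu (setK p q) /\
    is_mx_integral mu (setK p q)
      (fun z : 'cV[R]_p * 'cV[R]_q => (z.1 *m z.1^T) *t (z.2 *m z.2^T)) A.
Proof.
have mK : measurable (setK p q : set (borelRpq R p q)) := @setK_measurable R p q.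
split=> [/separable_product_states[r AE]|[mu [_ muA]]].
  (* Normalising both vectors of each pair [z] yields the weight [c z] and the atom [x z] of the
     measure. *)
  have /choice[c /choice[x cx]] : forall z : 'cV[R]_p * 'cV[R]_q, exists c x,
      [/\ 0 <= c, setK p q x & product_state z = c *: product_state x].
    move=> z; have [c1 [x1 [c10 x1u x1s x1E]]] := unit_rescale z.1 hp.
    have [c2 [x2 [c20 x2u x2s x2E]]] := unit_rescale z.2 hq.
    exists (c1 * c2), (x1, x2); split => //; first exact: mulr_ge0.
    by rewrite /product_state x1E x2E tensZmx tensmxZ scalerA.
  have c0 z : 0 <= c z by have [] := cx z.
  have Kx z : setK p q (x z) by have [] := cx z.
  have [mu [muK muf]] := @atomic_measure _ (borelRpq R p q) R _ mK _ r c x c0 Kx.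
  exists mu; split => // i j.
  have [imu intmu] := muf (fun z => product_state z i j)
    (measurable_funTS (continuous_borel_measurable
      (@product_state_continuous R p q i j))).
  split; first exact: imu.
  rewrite [LHS]intmu AE summxE; congr EFin.
  by apply: eq_bigr => z _; have [_ _ ->] := cx z; rewrite [RHS]mxE.
(* Matrices are flattened by [mxvec] to apply the barycenter lemma, with the flattened identity as
   [w]. *)
pose S : set 'rV[R]_(p * q * (p * q)) :=
  (fun z => mxvec (product_state z)) @` (setK p q).
have cS : compact S.
  apply: continuous_compact; last exact: setK_compact.
  apply: continuous_subspaceT; apply: continuous_mx => k l; rewrite (ord1 k).
  case/mxvec_indexP: l => i j; under eq_fun do rewrite mxvecE.
  exact: product_state_continuous.
have wS v : S v -> dot (mxvec 1%:M) v = 1.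
  by move=> [z Kz <-]; rewrite dot_mxvec1 mxtrace_product_state.
have [|k|k|L [c [v [c0 Sv AE]]]] := @conic_barycenter _ _ _ _ cS wS _
  (borelRpq R p q) mu (setK p q) (fun z => mxvec (product_state z))
  (mxvec A) mK.
- by move=> z Kz; exists z.
- case/mxvec_indexP: k => i j; under eq_fun do rewrite mxvecE.
  exact: (muA i j).1.
- case/mxvec_indexP: k => i j; under eq_integral do rewrite mxvecE.
  by rewrite mxvecE; exact: (muA i j).2.
have /choice[z zE] : forall i, exists z,
     setK p q z /\ mxvec (product_state z) = v i.
  by move=> i; have [z] := Sv i; exists z.
(* The nonnegative coefficient [c i] is absorbed into the first tensor factor. *)
split=> //; exists L, (fun i => c i *: ((z i).1 *m (z i).1^T)).
exists (fun i => (z i).2 *m (z i).2^T); split.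
- by move=> i; apply: psdmxZ => //; exact: psdmx_rank1.
- by move=> i; exact: psdmx_rank1.
apply: (can_inj mxvecK); rewrite AE linear_sum; apply: eq_bigr => i _.
by rewrite -(zE i).2 tensZmx linearZ.
Qed.
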